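(* Let $T$ be a complete first-order theory. If $T$ is weakly VC-minimal, then either $T$ is stable or $T$ interprets an infinite linear order.
   Context: $\mathfrak{C}$ denotes a monster model of $T$. ''Formula'' means a $\emptyset$-definable formula in the language of $T$ unless otherwise specified; $x$ denotes a single variable, $\overline{y}, \overline{z}$ finite tuples of variables, $\mathrm{lg}(\overline{y})$ the length of $\overline{y}$. For a tuple $\overline{c}$ from $\mathfrak{C}$, $\psi(\mathfrak{C};\overline{c}) = \{a \in \mathfrak{C} : \models \psi(a;\overline{c})\}$. Independence dimension of a formula: a formula $\psi(x;\overline{z})$ has independence dimension $\le 1$ if the family $\{\psi(\mathfrak{C};\overline{c}) : \overline{c} \in \mathfrak{C}^{\mathrm{lg}(\overline{z})}\}$ of subsets of $\mathfrak{C}$ contains no two distinct members $B_0, B_1$ that are independent, i.e. for which all four sets $B_0^{s} \cap B_1^{t}$ ($s,t \in \{0,1\}$) are nonempty, where $B^1 = B$ and $B^0 = \mathfrak{C} \setminus B$. Weakly VC-minimal: $T$ is weakly VC-minimal if for all formulas $\varphi(x;\overline{y})$ and all $\overline{b} \in \mathfrak{C}^{\mathrm{lg}(\overline{y})}$ there exist formulas $\psi_0(x;\overline{z}_0), \dots, \psi_{n-1}(x;\overline{z}_{n-1})$, each of independence dimension $\le 1$, and tuples $\overline{c}_0,\dots,\overline{c}_{n-1}$ from $\mathfrak{C}$ of the appropriate lengths such that $\varphi(x;\overline{b})$ is a boolean combination of the $\psi_i(x;\overline{c}_i)$ (up to equivalence in $\mathfrak{C}$). ''Stable'' and ''interprets''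 have their usual model-theoretic meanings. *)

(* Defs.v *)
From HB Require Import structures.
From mathcomp Require Import all_boot.
From mathcomp Require Import boolp classical_sets functions cardinality.

Set Implicit Arguments.
Unset Strict Implicit.
Unset Printing Implicit Defensive.

Local Open Scope classical_set_scope.
Local Open Scope card_scope.

Record language : Type := Language {
  funs : Type;
  rels : Type;
  fun_ar : funs -> nat;
  rel_ar : rels -> nat
}.

Record structure (L : language) : Type := Structure {
  carrier :> Type;
  carrier_inhabited : inhabited carrier;
  fun_interp : forall f : funs L, ('I_(fun_ar f) -> carrier) -> carrier;
  rel_interp : forall r : rels L, ('I_(rel_ar r) -> carrier) -> Prop
}.

(** Variables are the elements of an arbitrary type [V]; a quantifier binds the
    extra variable [None] of [option V].  Thus a formula phi(x; y_0,...,y_{n-1})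
    is an element of [formula L (unit + 'I_n)], one in tuples of lengths m, n an
    element of [formula L ('I_m + 'I_n)], and a sentence an element of
    [formula L void]. *)
Inductive term (L : language) (V : Type) : Type :=
| tVar : V -> term L V
| tApp : forall f : funs L, ('I_(fun_ar f) -> term L V) -> term L V.

Inductive formula (L : language) (V : Type) : Type :=
| fBot : formula L V
| fEq : term L V -> term L V -> formula L V
| fRel : forall r : rels L, ('I_(rel_ar r) -> term L V) -> formula L V
| fImp : formula L V -> formula L V -> formula L V
| fAll : formula L (option V) -> formula L V.

Arguments fBot {L V}.

Definition fNot (L : language) (V : Type) (phi : formula L V) : formula L V :=
  fImp phi fBot.

Fixpoint eval (L : language) (M : structure L) (V : Type) (v : V -> M)
    (t : term L V) : M :=
  match t with
  | tVar x => v x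
  | tApp f ts => fun_interp (fun i => eval v (ts i))
  end.

Fixpoint sat (L : language) (M : structure L) (V : Type) (v : V -> M)
    (phi : formula L V) : Prop :=
  match phi with
  | fBot => False
  | fEq s t => eval v s = eval v t
  | fRel r ts => rel_interp (fun i => eval v (ts i))
  | fImp p q => sat v p -> sat v q
  | fAll p => forall a : M, sat (fun o => oapp v a o) p
  end.

Definition join (V W X : Type) (v : V -> X) (w : W -> X) : V + W -> X :=
  fun s => match s with inl i => v i | inr j => w j end.

Definition sentence (L : language) : Type := formula L void.

Definition satisfies (L : language) (M : structure L) (phi : sentence L) : Prop :=
  sat (of_void M) phi.

Definition models (L : language) (M : structure L) (T : set (sentence L)) : Prop :=
  forall phi, T phi -> satisfies M phi.

Definition entails (L : language) (T : set (sentence L)) (phi : sentence L) : Prop :=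
  forall M : structure L, models M T -> satisfies M phi.

Definition complete_theory (L : language) (T : set (sentence L)) : Prop :=
  (exists M : structure L, models M T) /\
  (forall phi : sentence L, entails T phi \/ entails T (fNot phi)).

(** Cardinals are represented by types.  A subset of the
    structure [C] of cardinality at most |K| is the range of some
    [e : K -> C], or empty (which imposes no further condition below, since a
    type over the empty set is also a type over any set); so the next two
    notions are |K|^+-saturation and strong |K|^+-homogeneity. *)

Definition finitely_satisfiable (L : language) (C : structure L) (n : nat)
    (K : Type) (e : K -> C) (p : set (formula L ('I_n + K))) : Prop :=
  forall q, finite_set q -> q `<=` p ->
    exists a : 'I_n -> C, forall phi, q phi -> sat (join a e) phi.

Definition saturated (L : language) (C : structure L) (K : Type) : Prop :=
  forall (n : nat) (e : K -> C) (p : set (formula L ('I_n + K))),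
    finitely_satisfiable e p ->
    exists a : 'I_n -> C, forall phi, p phi -> sat (join a e) phi.

Definition automorphism (L : language) (C : structure L) (s : C -> C) : Prop :=
  [/\ bijective s,
      forall (f : funs L) (a : 'I_(fun_ar f) -> C),
        s (fun_interp a) = fun_interp (s \o a) &
      forall (r : rels L) (a : 'I_(rel_ar r) -> C),
        rel_interp (s \o a) <-> rel_interp a].

Definition strongly_homogeneous (L : language) (C : structure L) (K : Type) : Prop :=
  forall e e' : K -> C,
    (forall phi : formula L K, sat e phi <-> sat e' phi) ->
    exists s : C -> C, automorphism s /\ forall k, s (e k) = e' k.

Definition monster_model (L : language) (T : set (sentence L)) (K : Type)
    (C : structure L) : Prop :=
  [/\ models C T,
      [/\ [set: nat] #<= [set: K],
          [set: funs L] #<= [set: K] & [set: rels L] #<= [set: K]],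
      saturated C K & strongly_homogeneous C K].

(** In the following definitions [C] is meant to be a monster model of a complete
    theory, and the notions are those of that theory. *)

Definition instance (L : language) (C : structure L) (n : nat)
    (psi : formula L (unit + 'I_n)) (c : 'I_n -> C) : set C :=
  [set a | sat (join (fun _ : unit => a) c) psi].

Definition side (X : Type) (s : bool) (B : set X) : set X :=
  if s then B else ~` B.

Definition independent (X : Type) (B0 B1 : set X) : Prop :=
  forall s t : bool, side s B0 `&` side t B1 !=set0.

Definition indep_dim_le1 (L : language) (C : structure L) (n : nat)
    (psi : formula L (unit + 'I_n)) : Prop :=
  forall c0 c1 : 'I_n -> C, instance psi c0 <> instance psi c1 ->
    ~ independent (instance psi c0) (instance psi c1).

Inductive boolean_combination (X I : Type) (B : I -> set X) : set X -> Prop :=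
| bc_gen : forall i, boolean_combination B (B i)
| bc_setT : boolean_combination B setT
| bc_setC : forall A, boolean_combination B A -> boolean_combination B (~` A)
| bc_setI : forall A A', boolean_combination B A -> boolean_combination B A' ->
    boolean_combination B (A `&` A').

Definition weakly_VC_minimal (L : language) (C : structure L) : Prop :=
  forall (m : nat) (phi : formula L (unit + 'I_m)) (b : 'I_m -> C),
  exists (n : nat) (k : 'I_n -> nat)
    (psi : forall i : 'I_n, formula L (unit + 'I_(k i)))
    (c : forall i : 'I_n, 'I_(k i) -> C),
    (forall i, indep_dim_le1 C (psi i)) /\
    boolean_combination (fun i => instance (psi i) (c i)) (instance phi b).

Definition order_property (L : language) (C : structure L) (m n : nat)
    (phi : formula L ('I_m + 'I_n)) : Prop :=
  exists (a : nat -> 'I_m -> C) (b : nat -> 'I_n -> C),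
    forall i j : nat, sat (join (a i) (b j)) phi <-> (i < j)%N.

Definition stable (L : language) (C : structure L) : Prop :=
  forall (m n : nat) (phi : formula L ('I_m + 'I_n)), ~ order_property C phi.

(** Parameters are allowed in [definable].  The domain of [N] is the image of a
    definable set of n-tuples from [M], and equality and the basic functions and
    relations of [N] pull back to definable relations. *)

Definition definable (L : language) (M : structure L) (V : Type)
    (D : set (V -> M)) : Prop :=
  exists (k : nat) (phi : formula L (V + 'I_k)) (c : 'I_k -> M),
    D = [set v | sat (join v c) phi].

Definition interprets (L L' : language) (M : structure L) (N : structure L') : Prop :=
  exists (n : nat) (D : set ('I_n -> M)) (f : ('I_n -> M) -> N),
  [/\ definable D,
      f @` D = [set: N],
      definable [set v : 'I_n + 'I_n -> M |
        [/\ D (v \o inl), D (v \o inr) & f (v \o inl) = f (v \o inr)]],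
      forall g : funs L',
        definable [set v : ('I_(fun_ar g) * 'I_n) + 'I_n -> M |
          [/\ forall i, D (fun j => v (inl (i, j))), D (v \o inr) &
              fun_interp (fun i => f (fun j => v (inl (i, j)))) = f (v \o inr)]] &
      forall r : rels L',
        definable [set v : 'I_(rel_ar r) * 'I_n -> M |
          (forall i, D (fun j => v (i, j))) /\
          rel_interp (fun i => f (fun j => v (i, j)))]].

Definition order_language : language :=
  @Language void unit (fun _ => 0%N) (fun _ => 2%N).

Definition leN (N : structure order_language) (x y : N) : Prop :=
  @rel_interp order_language N tt (fun i : 'I_2 => if i == ord0 then x else y).

Definition linear_order (N : structure order_language) : Prop :=
  [/\ forall x : N, leN x x,
      forall x y : N, leN x y -> leN y x -> x = y,
      forall x y z : N, leN x y -> leN y z -> leN x z &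
      forall x y : N, leN x y \/ leN y x].

Definition interprets_infinite_linear_order (L : language) (C : structure L) : Prop :=
  exists N : structure order_language,
    [/\ linear_order N, infinite_set [set: N] & interprets C N].

(* Main.v *)
Require Import Defs.
From mathcomp Require Import all_boot.
From mathcomp Require Import zify.
From mathcomp Require Import boolp classical_sets functions cardinality.

Set Implicit Arguments.
Unset Strict Implicit.
Unset Printing Implicit Defensive.

Local Open Scope classical_set_scope.
Local Open Scope card_scope.

(** Call a family of sets tame if it shatters no binary mistake tree of large
    depth, i.e. has finite Littlestone dimension (Shelah's 2-rank).

    If all formulas in one free variable are tame, then so are all formulas in
    finitely many variables, and the theory is stable.  For phi(x1, x2; y), a
    learner of the fibre over x1 predicts phi(x1, x2; y) by a formula in x1
    alone, which is tame, and each wrong prediction lowers the rank of the fibre.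

    Tameness passes to boolean combinations and, by saturation, from the formulas
    of independence dimension at most 1 to all formulas in one variable.  So in
    the unstable case some psi(x; z) of independence dimension at most 1 is not
    tame.  Going down a deep mistake tree always away from a given point a, one
    reaches a point a' separated from a by many distinct instances of psi; by
    saturation, some a and a' are such that infinitely many instances of psi
    contain a and not a'.  Any two of these meet and do not cover, so that they
    are comparable, and inclusion is the interpreted infinite linear order. *)

(** * Induction on finite sets *)

Lemma finite_set_ind (T : Type) (P : set T -> Prop) :
  P set0 -> (forall A x, P A -> P (x |` A)) ->
  forall A, finite_set A -> P A.
Proof.
move=> P0 PU A /(@finite_seqP {classic T}) [s ->].
elim: s => [|x s IHs]; first by rewrite set_nil.
suff -> : [set` x :: s] = x |` [set` s] by exact: PU.
by apply/predeqP => y /=; rewrite inE; split=> [/orP[/eqP|]|[/eqP->|->]];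
  [left|right| |rewrite orbT].
Qed.

(** * Littlestone dimension *)

Section Littlestone.
Variable X : Type.
Implicit Types (F G : set (set X)) (A B : set X).

(** There is a complete binary tree of depth [n] with labels in [F], all of whose branches are
    realised in [A]. The empty set fails even at depth 0. *)
Fixpoint littlestone F (n : nat) A : Prop :=
  if n is n'.+1 then
    exists B, [/\ F B, littlestone F n' (A `&` B) & littlestone F n' (A `\` B)]
  else A !=set0.

Definition tame F := exists n, ~ littlestone F n setT.

Lemma littlestone_sub F G n A B :
  F `<=` G -> A `<=` B -> littlestone F n A -> littlestone G n B.
Proof.
move=> FG; elim: n A B => [|n IHn] A B AB /=; first by case=> x /AB; exists x.
case=> D [FD D1 D0]; exists D; split; first exact: FG.
  by apply: IHn D1; exact: setSI.
by apply: IHn D0; exact: setSD.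
Qed.

Lemma littlestone_nonempty F n A : littlestone F n A -> A !=set0.
Proof.
elim: n A => [//|n IHn] A /= [B [_ /IHn[x [Ax _]] _]]; by exists x.
Qed.

Lemma littlestone_leq F m n A :
  (m <= n)%N -> littlestone F n A -> littlestone F m A.
Proof.
elim: m n A => [|m IHm] [|n] A //; first by move=> _ /littlestone_nonempty.
move=> mn [B [FB B1 B0]].
by exists B; split => //; apply: IHm mn _.
Qed.

Lemma tame_sub F G : F `<=` G -> tame G -> tame F.
Proof.
move=> FG [n Gn]; exists n; apply: contra_not Gn.
exact: littlestone_sub.
Qed.

(** Induction on a bound for [p + q]: if [B] has no tree of depth [q], neither have its pieces, so a
    root label [D] leaves trees of depth [p - 1] on both sides of [A], and [D] joins them. *)
Lemma littlestoneU F p q A B :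
  littlestone F (p + q) (A `|` B) -> littlestone F p A \/ littlestone F q B.
Proof.
move: {2}(p + q)%N (leqnn (p + q)) => k.
elim: k p q A B => [|k IHk] [|p] [|q] A B; rewrite ?addn0 ?add0n //= => pqk.
- by case=> x [Ax|Bx]; [left|right]; exists x.
- by case=> x [Ax|Bx]; [left|right]; exists x.
- have [[x Ax] _|/set0P/negP/negPn/eqP ->] := pselect (A !=set0).
    by left; exists x.
  by rewrite set0U; right.
- have [[x Bx] _|/set0P/negP/negPn/eqP ->] := pselect (B !=set0).
    by right; exists x.
  by rewrite setU0; left.
case=> D [FD]; rewrite setIUl setDUl => D1 D0.
have [Bq|nBq] := pselect (littlestone F q.+1 B); first by right.
left; exists D; split=> //.
  case: (IHk p q.+1 (A `&` D) (B `&` D)) => //.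
  by move=> BD; case: nBq; apply: littlestone_sub BD => // x [].
case: (IHk p q.+1 (A `\` D) (B `\` D)) => //.
by move=> BD; case: nBq; apply: littlestone_sub BD => // x [].
Qed.

Lemma littlestone_setC F n A :
  littlestone [set ~` B | B in F] n A -> littlestone F n A.
Proof.
elim: n A => [//|n IHn] A /= [_ [[B FB <-] /IHn B0 /IHn B1]].
by exists B; split=> //; move: B1; rewrite !setDE setCK.
Qed.

Lemma tame_setC F : tame F -> tame [set ~` B | B in F].
Proof. by case=> n Fn; exists n => /littlestone_setC. Qed.

(** Say the root label is in [F]. If neither subtree yields a [G]-tree of depth [q], both yield
    [F]-trees of depth [p - 1], which the root joins. The induction needs this for every set in
    place of [setT]. *)
Lemma tame_setU F G : tame F -> tame G -> tame (F `|` G).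
Proof.
move=> [p Fp] [q Gq]; exists (p + q) => H.
have {Fp Gq} : ~ (littlestone F p setT \/ littlestone G q setT) by case.
apply; move: H; move: {2}(p + q)%N (leqnn (p + q)) setT => k.
elim: k p q => [|k IHk] [|p] [|q]; rewrite ?addn0 ?add0n //= => pqk A.
- by left.
- by left.
- by case=> B [_ /littlestone_nonempty[x [Ax _]]]; left; exists x.
- by case=> B [_ /littlestone_nonempty[x [Ax _]]]; right; exists x.
have pqk1 : (p.+1 + q <= k)%N by lia.
have pqk2 : (p + q.+1 <= k)%N by lia.
case=> B [[FB|GB] B1 B0].
- case: (IHk _ _ pqk2 _ B1) => [F1|]; last first.
    by move=> H; right; apply: littlestone_sub H => // x [].
  case: (IHk _ _ pqk2 _ B0) => [F0|]; last first.
    by move=> H; right; apply: littlestone_sub H => // x [].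
  by left; exists B.
- rewrite addnS -addSn in B1 B0.
  case: (IHk _ _ pqk1 _ B1) => [|F1].
    by move=> H; left; apply: littlestone_sub H => // x [].
  case: (IHk _ _ pqk1 _ B0) => [|F0].
    by move=> H; left; apply: littlestone_sub H => // x [].
  by right; exists B.
Qed.

(** The negative side of a label $B \cap D$ is $(A \setminus D) \cup (A \setminus B)$, so by
    [littlestoneU] one of the two is deep. If it is $A \setminus D$, then $A \cap D$, which contains
    the positive side, is deep as well; induction on both gives two [G]-trees joined by [D], unless
    there already is an [F]-tree of depth [p]. The other case is symmetric. *)
Lemma littlestone_setI F G p q : exists n, forall A,
  littlestone [set B `&` D | B in F & D in G] n A ->
  littlestone F p A \/ littlestone G q A.
Proof.
move: {2}(p + q)%N (leqnn (p + q)) => k.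
elim: k p q => [|k IHk] [|p] [|q]; rewrite ?addn0 ?add0n // => pqk.
- by exists 0%N; left.
- by exists 0%N; left.
- by exists 0%N; left.
- by exists 0%N; right.
have [m1 H1] := IHk p.+1 q ltac:(lia).
have [m2 H2] := IHk p q.+1 ltac:(lia).
exists (m1 + m2).+1 => A [_ [[B FB [D GD <-]]]].
set I := [set _ | _ in _ & _ in _] => T1 T0.
have {T0} : littlestone I m1 (A `\` D) \/ littlestone I m2 (A `\` B).
  by apply: littlestoneU; rewrite -setDIr setIC in T0 *.
case=> T0.
  have {T1} T1 : littlestone I m1 (A `&` D).
    apply: littlestone_leq (leq_addr m2 m1) _.
    by apply: littlestone_sub T1 => // x [Ax [Bx Dx]].
  case: (H1 _ T1) => [|G1].
    by move=> H; left; apply: littlestone_sub H => // x [].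
  case: (H1 _ T0) => [|G0].
    by move=> H; left; apply: littlestone_sub H => // x [].
  by right; exists D.
have {T1} T1 : littlestone I m2 (A `&` B).
  apply: littlestone_leq (leq_addl m1 m2) _.
  by apply: littlestone_sub T1 => // x [Ax [Bx Dx]].
case: (H2 _ T1) => [F1|]; last first.
  by move=> H; right; apply: littlestone_sub H => // x [].
case: (H2 _ T0) => [F0|]; last first.
  by move=> H; right; apply: littlestone_sub H => // x [].
by left; exists B.
Qed.

Lemma tame_setI F G :
  tame F -> tame G -> tame [set B `&` D | B in F & D in G].
Proof.
move=> [p Fp] [q Gq]; have [n H] := littlestone_setI F G p q.
by exists n => /H[].
Qed.

(** Let the root label [B] be approximated by [E]. One of the halves cut by [E] has smaller rank for
    [G], and the matching half cut by [B] exceeds it only by part of the symmetric difference, which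
    has no [F]-tree of depth [M]. So each step of the induction on [e] costs [M.+1] levels: the root
    and [M] more. *)
Lemma littlestone_approx F G M e A :
  (forall B, F B -> exists2 E, G E & ~ littlestone F M (A `&` (B `+` E))) ->
  ~ littlestone G e A -> ~ littlestone F (e * M.+1) A.
Proof.
elim: e A => [//|e IHe] A FG nG; rewrite mulSn addSn /=.
case=> B [FB B1 B0]; have [E GE nFM] := FG B FB.
have FGA A' : A' `<=` A ->
    forall B, F B -> exists2 E, G E & ~ littlestone F M (A' `&` (B `+` E)).
  move=> A'A D FD; have [E' GE' H] := FG D FD; exists E' => //.
  by apply: contra_not H; apply: littlestone_sub => // x [/A'A].
have : ~ (littlestone G e (A `&` E) /\ littlestone G e (A `\` E)).
  by case=> ? ?; apply: nG; exists E.
move=> /not_andP[] /IHe; [have sA : A `&` E `<=` A by move=> x []|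
                         have sA : A `\` E `<=` A by move=> x []];
  move=> /(_ (FGA _ sA)); apply.
  have := @littlestoneU F M (e * M.+1) (A `&` (B `+` E)) (A `&` E).
  case=> //; apply: littlestone_sub B1 => // x [Ax Bx].
  by have [Ex|Ex] := pselect (E x); [right|left; split=> //; left].
have := @littlestoneU F M (e * M.+1) (A `&` (B `+` E)) (A `\` E).
case=> //; apply: littlestone_sub B0 => // x [Ax Bx].
by have [Ex|Ex] := pselect (E x); [left; split=> //; right|right].
Qed.

(* Descend the tree, always away from [a]. *)
Lemma littlestone_separating F n A a : littlestone F n A ->
  exists (a' : X) (s : seq (set X)),
    [/\ A a', size s = n, uniq s &
        forall B, B \in s -> [/\ F B, ~ (B a <-> B a'),
                                A `&` B !=set0 & A `\` B !=set0]].
Proof.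
elim: n A => [|n IHn] A; first by case=> x Ax; exists x, [::].
case=> B [FB B1 B0].
have nB1 := littlestone_nonempty B1; have nB0 := littlestone_nonempty B0.
have [Ba|Ba] := pselect (B a).
  have [a' [s [[Aa' nBa'] ss us sP]]] := IHn _ B0.
  exists a', (B :: s); split=> //=; first by rewrite ss.
    (* Later labels cut the half reached, on which [B] is constant, so they differ from [B]. *)
    rewrite us andbT; apply/negP => /sP[_ _ [x [[_ nBx] Bx]]] //.
  move=> D; rewrite inE => /orP[/eqP ->|/sP[FD D' [x [[Ax _] Dx]] [y [[Ay _] Dy]]]].
    by split=> //; case=> /(_ Ba).
  by split=> //; [exists x|exists y].
have [a' [s [[Aa' nBa'] ss us sP]]] := IHn _ B1.
exists a', (B :: s); split=> //=; first by rewrite ss.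
  rewrite us andbT; apply/negP => /sP[_ _ _ [x [[_ nBx] Bx]]] //.
move=> D; rewrite inE => /orP[/eqP ->|/sP[FD D' [x [[Ax _] Dx]] [y [[Ay _] Dy]]]].
  by split=> //; case=> _ /(_ nBa').
by split=> //; [exists x|exists y].
Qed.

(** A tree of depth [n + n] gives [n + n] labels that each contain exactly one of two points, so at
    least [n] of them contain the same one. If that is the second point, the two are exchanged. *)
Lemma not_tame_separating F n : inhabited X -> ~ tame F ->
  exists (a a' : X) (s : seq (set X)),
    [/\ size s = n, uniq s & forall B, B \in s -> [/\ F B, B a & ~ B a']].
Proof.
case=> a nF; have : littlestone F (n + n) setT.
  by apply: contrapT => H; apply: nF; exists (n + n)%N.
move=> /(littlestone_separating a)[a' [s [_ ss us sP]]].
have := count_predC (fun B : set X => `[< B a >]) s; rewrite ss -!size_filter.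
set s1 := [seq B <- s | _]; set s2 := [seq B <- s | _] => s12.
have [n1|n1] := leqP n (size s1).
  exists a, a', (take n s1); split.
  - by rewrite size_takel.
  - by rewrite take_uniq ?filter_uniq.
  move=> B /mem_take; rewrite mem_filter => /andP[/asboolP Ba /sP[FB H _ _]].
  by split=> // Ba'; apply: H.
have n2 : (n <= size s2)%N by lia.
exists a', a, (take n s2); split.
- by rewrite size_takel.
- by rewrite take_uniq ?filter_uniq.
move=> B /mem_take; rewrite mem_filter => /andP[/asboolP Ba /sP[FB H _ _]].
by split=> //; apply: contrapT => Ba'; apply: H.
Qed.

End Littlestone.

(** * Preimages and ladders *)

Lemma littlestone_preimage (X Y : Type) (f : X -> Y) (F : set (set Y)) n A :
  littlestone [set f @^-1` B | B in F] n A -> littlestone F n (f @` A).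
Proof.
elim: n A => [|n IHn] A /=; first by case=> x Ax; exists (f x), x.
move=> [_ [[B FB <-] /IHn B1 /IHn B0]]; exists B; split=> //.
  by apply: littlestone_sub B1 => // _ [x [Ax Bx] <-]; split=> //; exists x.
by apply: littlestone_sub B0 => // _ [x [Ax Bx] <-]; split=> //; exists x.
Qed.

Lemma tame_preimage (X Y : Type) (f : X -> Y) (F : set (set Y)) :
  tame F -> tame [set f @^-1` B | B in F].
Proof.
case=> n nF; exists n => /littlestone_preimage; apply: contra_not nF.
exact: littlestone_sub.
Qed.

(** Binary search: the labels cut intervals of indices, of length a power of 2, at their
    midpoints. *)
Lemma littlestone_ladder (X Y : Type) (R : Y -> set X) (a : nat -> X)
    (b : nat -> Y) n :
  (forall i j, R (b j) (a i) <-> (i < j)%N) -> littlestone (range R) n setT.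
Proof.
move=> Rab.
suff H s : littlestone (range R) n [set a i | i in [set i | s <= i < s + 2 ^ n]%N].
  by apply: littlestone_sub (H 0%N).
elim: n s => [|n IHn] s /=.
  by exists (a s), s => //=; rewrite expn0; lia.
exists (R (b (s + 2 ^ n)%N)); split; first by exists (b (s + 2 ^ n)%N).
  apply: littlestone_sub (IHn s) => // _ [i /= ilt <-]; split.
    by exists i => //=; rewrite expnS; lia.
  by apply/Rab; lia.
apply: littlestone_sub (IHn (s + 2 ^ n)%N) => // _ [i /= ilt <-]; split.
  by exists i => //=; rewrite expnS; lia.
by move=> /Rab; lia.
Qed.

(** * Definable relations *)

Section Renaming.
Variable L : language.

Fixpoint rename_term (V W : Type) (f : V -> W) (t : term L V) : term L W :=
  match t with
  | tVar x => tVar L (f x)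
  | tApp g ts => tApp (fun i => rename_term f (ts i))
  end.

Fixpoint rename (V W : Type) (f : V -> W) (phi : formula L V) : formula L W :=
  match phi with
  | fBot => fBot
  | fEq s t => fEq (rename_term f s) (rename_term f t)
  | fRel r ts => fRel (fun i => rename_term f (ts i))
  | fImp p q => fImp (rename f p) (rename f q)
  | fAll p => fAll (rename (omap f) p)
  end.

Variable C : structure L.

Lemma eval_rename (V W : Type) (f : V -> W) (v : W -> C) (t : term L V) :
  eval v (rename_term f t) = eval (v \o f) t.
Proof.
elim: t => //= g ts IHts; congr fun_interp.
by apply/funext => i; exact: IHts.
Qed.

Lemma sat_rename (V W : Type) (f : V -> W) (v : W -> C) (phi : formula L V) :
  sat v (rename f phi) <-> sat (v \o f) phi.
Proof.
elim: phi W f v => {V} [|V s t|V r ts|V p IHp q IHq|V p IHp] W f v //=.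
- by rewrite !eval_rename.
- suff -> : (fun i => eval v (rename_term f (ts i))) =
            (fun i => eval (v \o f) (ts i)) by [].
  by apply/funext => i; rewrite eval_rename.
- by rewrite IHp IHq.
split=> H a; have := H a; rewrite IHp; congr (sat _ p);
  by apply/funext; case.
Qed.

End Renaming.

Section Definability.
Variables (L : language) (C : structure L).

(** Definability without parameters, for relations between the values of variables. Closure under
    the logical operations and under maps of variables then replaces the writing of formulas. *)
Definition zdefinable (V : Type) (P : (V -> C) -> Prop) : Prop :=
  exists phi : formula L V, forall v, sat v phi <-> P v.

Lemma zdefinable_ext (V : Type) (P Q : (V -> C) -> Prop) :
  (forall v, P v <-> Q v) -> zdefinable P -> zdefinable Q.
Proof. by move=> PQ [phi phiP]; exists phi => v; rewrite phiP. Qed.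

Lemma zdefinable_sat (V : Type) (phi : formula L V) :
  zdefinable (fun v : V -> C => sat v phi).
Proof. by exists phi. Qed.

Lemma zdefinable_comp (V W : Type) (f : V -> W) (P : (V -> C) -> Prop) :
  zdefinable P -> zdefinable (fun w => P (w \o f)).
Proof. by case=> phi phiP; exists (rename f phi) => w; rewrite sat_rename. Qed.

Lemma zdefinable_False (V : Type) : zdefinable (fun _ : V -> C => False).
Proof. by exists fBot. Qed.

Lemma zdefinable_imp (V : Type) (P Q : (V -> C) -> Prop) :
  zdefinable P -> zdefinable Q -> zdefinable (fun v => P v -> Q v).
Proof.
by move=> [p pP] [q qQ]; exists (fImp p q) => v /=; rewrite pP qQ.
Qed.

Lemma zdefinable_not (V : Type) (P : (V -> C) -> Prop) :
  zdefinable P -> zdefinable (fun v => ~ P v).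
Proof. by move=> dP; apply: zdefinable_imp => //; exact: zdefinable_False. Qed.

Lemma zdefinable_True (V : Type) : zdefinable (fun _ : V -> C => True).
Proof.
by apply: zdefinable_ext (zdefinable_not (zdefinable_False V)) => v; split=> // _ [].
Qed.

Lemma zdefinable_and (V : Type) (P Q : (V -> C) -> Prop) :
  zdefinable P -> zdefinable Q -> zdefinable (fun v => P v /\ Q v).
Proof.
move=> dP dQ; apply: (@zdefinable_ext _ (fun v => ~ (P v -> ~ Q v))).
  by move=> v; rewrite not_implyP not_notP.
by apply/zdefinable_not/zdefinable_imp => //; exact: zdefinable_not.
Qed.

Lemma zdefinable_iff (V : Type) (P Q : (V -> C) -> Prop) :
  zdefinable P -> zdefinable Q -> zdefinable (fun v => P v <-> Q v).
Proof. by move=> dP dQ; apply: zdefinable_and; exact: zdefinable_imp. Qed.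

Lemma zdefinable_forall1 (V : Type) (P : (V -> C) -> C -> Prop) :
  zdefinable (fun v : option V -> C => P (v \o Some) (v None)) ->
  zdefinable (fun v => forall a, P v a).
Proof.
case=> phi phiP; exists (fAll phi) => v /=.
by split=> H a; have := phiP (fun o => oapp v a o) => -[P1 P2];
  [exact: P1 (H a)|exact: P2 (H a)].
Qed.

Lemma zdefinable_forall_ord n (V : Type) (P : (V -> C) -> ('I_n -> C) -> Prop) :
  zdefinable (fun v : V + 'I_n -> C => P (v \o inl) (v \o inr)) ->
  zdefinable (fun v => forall w, P v w).
Proof.
elim: n V P => [|n IHn] V P dP.
  pose f (x : V + 'I_0) : V := match x with
    | inl y => y | inr i => False_rect V (notF (ltn_ord i)) end.
  apply: zdefinable_ext (zdefinable_comp f dP) => v.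
  split=> [Pv w|]; last exact.
  by suff -> : w = (v \o f) \o inr by []; apply/funext => -[].
pose cons (a : C) (w : 'I_n -> C) (i : 'I_n.+1) :=
  if unlift ord0 i is Some j then w j else a.
(* The first of the [n.+1] bound variables becomes [None]; the others are left to the induction
   hypothesis. *)
pose g (x : V + 'I_n.+1) : option V + 'I_n := match x with
  | inl y => inl (Some y)
  | inr i => if unlift ord0 i is Some j then inr j else inl None end.
pose Q v a := forall w, P v (cons a w).
apply: (@zdefinable_ext _ (fun v => forall a, Q v a)).
  move=> v; split=> [Pv w|Pv a w]; last exact.
  suff -> : w = cons (w ord0) (w \o lift ord0) by exact: Pv.
  by apply/funext => i; rewrite /cons; case: unliftP => [j|] ->.
apply/zdefinable_forall1/IHn.
apply: zdefinable_ext (zdefinable_comp g dP) => v.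
suff -> : (v \o g) \o inr = cons ((v \o inl) None) (v \o inr) by [].
by apply/funext => i; rewrite /cons /=; case: unlift.
Qed.

Lemma zdefinable_forall (W : finType) (V : Type)
    (P : (V -> C) -> (W -> C) -> Prop) :
  zdefinable (fun v : V + W -> C => P (v \o inl) (v \o inr)) ->
  zdefinable (fun v => forall w, P v w).
Proof.
move=> dP.
pose g (x : V + W) : V + 'I_#|W| := match x with
  | inl y => inl y | inr i => inr (enum_rank i) end.
apply: (@zdefinable_ext _ (fun v => forall u : 'I_#|W| -> C, P v (u \o enum_rank))).
  move=> v; split=> [Pv w|Pv u]; last exact.
  suff -> : w = (w \o enum_val) \o enum_rank by exact: Pv.
  by apply/funext => i /=; rewrite enum_rankK.
apply: zdefinable_forall_ord.
exact: (zdefinable_comp g dP).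
Qed.

Lemma zdefinable_exists (W : finType) (V : Type)
    (P : (V -> C) -> (W -> C) -> Prop) :
  zdefinable (fun v : V + W -> C => P (v \o inl) (v \o inr)) ->
  zdefinable (fun v => exists w, P v w).
Proof.
move=> dP; apply: (@zdefinable_ext _ (fun v => ~ forall w, ~ P v w)).
  by move=> v; rewrite -not_existsP.
apply/zdefinable_not/zdefinable_forall.
exact: (zdefinable_not dP).
Qed.

Lemma zdefinable_all (I : finType) (V : Type) (P : I -> (V -> C) -> Prop) :
  (forall i, zdefinable (P i)) -> zdefinable (fun v => forall i, P i v).
Proof.
move=> dP; apply: (@zdefinable_ext _ (fun v => forall i, i \in enum I -> P i v)).
  by move=> v; split=> H i; [apply: H; rewrite mem_enum|].
elim: (enum I) => [|i s IHs].
  by apply: zdefinable_ext (zdefinable_True V).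
apply: zdefinable_ext (zdefinable_and (dP i) IHs) => v; split.
  by case=> Pi Ps j; rewrite inE => /orP[/eqP ->|/Ps].
by move=> H; split=> [|j js]; apply: H; rewrite inE ?eqxx // js orbT.
Qed.

Lemma definable_zdefinable (V : Type) (k : nat) (P : (V + 'I_k -> C) -> Prop)
    (c : 'I_k -> C) : zdefinable P -> definable [set v | P (join v c)].
Proof.
case=> phi phiP; exists k, phi, c; apply/predeqP => v /=.
by rewrite phiP.
Qed.

Lemma zdefinable_instance (V : Type) n (psi : formula L (unit + 'I_n)) (x : V)
    (y : 'I_n -> V) :
  zdefinable (fun v : V -> C => instance psi (v \o y) (v x)).
Proof.
apply: zdefinable_ext (zdefinable_comp (join (fun=> x) y) (zdefinable_sat psi)) => v.
have -> : v \o join (fun _ : unit => x) y = join (fun _ : unit => v x) (v \o y).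
  by apply/funext => -[].
by [].
Qed.

(** For fixed [n] the existence of a tree is first-order: quantify over the parameters [I] of the
    root label, then express both subtrees with these parameters added to the free variables [V].
    This is why [S] depends on the free variables. *)
Lemma zdefinable_littlestone (I J : finType) n (V : Type)
    (R : (V -> C) -> (I -> C) -> (J -> C) -> Prop)
    (S : (V -> C) -> (J -> C) -> Prop) :
  zdefinable (fun v : (V + I) + J -> C =>
    R (v \o inl \o inl) (v \o inl \o inr) (v \o inr)) ->
  zdefinable (fun v : V + J -> C => S (v \o inl) (v \o inr)) ->
  zdefinable (fun v : V -> C => littlestone (range (R v)) n (S v)).
Proof.
elim: n V R S => [|n IHn] V R S dR dS /=; first exact: zdefinable_exists.
pose R' (v : V + I -> C) := R (v \o inl).
pose S1 (v : V + I -> C) := S (v \o inl) `&` R (v \o inl) (v \o inr).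
pose S0 (v : V + I -> C) := S (v \o inl) `\` R (v \o inl) (v \o inr).
apply: (@zdefinable_ext _ (fun v => exists y,
    littlestone (range (R v)) n (S v `&` R v y) /\
    littlestone (range (R v)) n (S v `\` R v y))).
  move=> v; split=> [[y [? ?]]|[_ [[y _ <-] ? ?]]]; last by exists y.
  by exists (R v y); split=> //; exists y.
apply: zdefinable_exists.
have dR' : zdefinable (fun v : (V + I + I) + J -> C =>
    R' (v \o inl \o inl) (v \o inl \o inr) (v \o inr)).
  pose g (x : V + I + J) : (V + I + I) + J := match x with
    | inl (inl y) => inl (inl (inl y)) | inl (inr i) => inl (inr i)
    | inr j => inr j end.
  exact: (zdefinable_comp g dR).
have dS' : zdefinable (fun v : (V + I) + J -> C => S (v \o inl \o inl) (v \o inr)).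
  pose g (x : V + J) : (V + I) + J := match x with
    | inl y => inl (inl y) | inr j => inr j end.
  exact: (zdefinable_comp g dS).
apply: zdefinable_and.
  apply: (IHn _ R' S1) => //.
  exact: zdefinable_and dS' dR.
apply: (IHn _ R' S0) => //.
exact: zdefinable_and dS' (zdefinable_not dR).
Qed.

End Definability.

(** * Reduction to one variable *)

Section OneVariable.
Variables (L : language) (C : structure L).

Hypothesis tame1 : forall k (theta : formula L (unit + 'I_k)),
  tame (range (@instance L C k theta)).

Lemma tame_zdefinable1 (P : finType) (D : (P -> C) -> C -> Prop) :
  zdefinable (fun v : unit + P -> C => D (v \o inr) (v (inl tt))) ->
  tame (range D).
Proof.
pose g (x : unit + P) : unit + 'I_#|P| := match x with
  | inl y => inl y | inr i => inr (enum_rank i) end.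
move=> /(zdefinable_comp g)[theta thetaP].
apply: tame_sub (tame1 theta) => _ [p _ <-]; exists (p \o enum_val) => //.
apply/predeqP => a; rewrite /instance /= thetaP /=.
have -> // : (join (fun=> a) (p \o enum_val) \o g) \o inr = p.
by apply/funext => i /=; rewrite enum_rankK.
Qed.

(* [d] bounds the rank of every fibre of [S] over the first coordinate.  The
   prediction "[R y] holds on the half of the fibre with full rank" depends on
   the first coordinate only, and where it fails the rank of the fibre drops. *)
Lemma littlestone_fibres (I J : finType) (R : (I -> C) -> C -> (J -> C) -> Prop) :
  zdefinable (fun v : (I + unit) + J -> C =>
    R (v \o inl \o inl) (v (inl (inr tt))) (v \o inr)) ->
  forall d (P : finType) (S : (P -> C) -> C -> (J -> C) -> Prop),
  zdefinable (fun v : (P + unit) + J -> C =>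
    S (v \o inl \o inl) (v (inl (inr tt))) (v \o inr)) ->
  (forall p a, ~ littlestone (range (fun y => R y a)) d (S p a)) ->
  exists e, forall p, ~ littlestone
    (range (fun y (x : C * (J -> C)) => R y x.1 x.2)) e [set x | S p x.1 x.2].
Proof.
move=> dR; elim=> [|d IHd] P S dS nS.
  by exists 0%N => p [[a b] /= Sab]; apply: (nS p a); exists b.
pose D (q : P + I -> C) (a : C) := littlestone (range (fun y => R y a)) d
  (S (q \o inl) a `&` R (q \o inr) a).
have dD : zdefinable (fun v : unit + (P + I) -> C => D (v \o inr) (v (inl tt))).
  apply: (@zdefinable_littlestone L C I J d (unit + (P + I))%type
    (fun v y => R y (v (inl tt)))
    (fun v => S (v \o inr \o inl) (v (inl tt)) `&` R (v \o inr \o inr) (v (inl tt)))).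
    pose g (x : (I + unit) + J) : (unit + (P + I) + I) + J := match x with
      | inl (inl y) => inl (inr y) | inl (inr i) => inl (inl (inl tt))
      | inr j => inr j end.
    exact: (zdefinable_comp g dR).
  pose g (x : (I + unit) + J) : (unit + (P + I)) + J := match x with
    | inl (inl y) => inl (inr (inr y)) | inl (inr i) => inl (inl tt)
    | inr j => inr j end.
  pose h (x : (P + unit) + J) : (unit + (P + I)) + J := match x with
    | inl (inl y) => inl (inr (inl y)) | inl (inr i) => inl (inl tt)
    | inr j => inr j end.
  exact: zdefinable_and (zdefinable_comp h dS) (zdefinable_comp g dR).
have [e nDe] := tame_zdefinable1 dD.
pose S' (q : P + I -> C) a b :=
  S (q \o inl) a b /\ ~ (R (q \o inr) a b <-> D q a).
(* [S'] collects the mistakes of a prediction. The parameters of the prediction join those of [S],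
   so that [M] is uniform in both. *)
have [||M nM] := IHd (P + I)%type S'.
- pose g (x : (I + unit) + J) : ((P + I) + unit) + J := match x with
    | inl (inl y) => inl (inl (inr y)) | inl (inr i) => inl (inr tt)
    | inr j => inr j end.
  pose h (x : (P + unit) + J) : ((P + I) + unit) + J := match x with
    | inl (inl y) => inl (inl (inl y)) | inl (inr i) => inl (inr tt)
    | inr j => inr j end.
  pose k (x : unit + (P + I)) : ((P + I) + unit) + J := match x with
    | inl _ => inl (inr tt) | inr y => inl (inl y) end.
  apply: zdefinable_and; first exact: (zdefinable_comp h dS).
  apply/zdefinable_not/zdefinable_iff; first exact: (zdefinable_comp g dR).
  exact: (zdefinable_comp k dD).
(* If the prediction is false, the mistakes lie in the half where [R] holds, which has no tree of
   depth [d]. If it is true, they lie in the other half, and trees of depth [d] on both would give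
   the fibre one of depth [d.+1]. *)
- move=> q a S'd; have [Dq|nDq] := pselect (D q a); last first.
    apply: (nDq); apply: littlestone_sub S'd => // b [Sb nRD]; split=> //.
    by apply: contrapT => nR; apply: nRD; split.
  apply: (nS (q \o inl) a); exists (R (q \o inr) a); split=> //.
  apply: littlestone_sub S'd => // b [Sb nRD]; split=> // Rb.
  by apply: nRD; split.
(* [e] bounds the depth of trees labelled by predictions, [M] that of trees on the mistakes of one
   prediction. *)
exists (e * M.+1)%N => p.
apply: (@littlestone_approx _ _
  [set fst @^-1` B | B in range (fun y => D (join p y))]).
  move=> _ [y _ <-]; exists (fst @^-1` D (join p y)).
    by exists (D (join p y)) => //; exists y.
  apply: contra_not (nM (join p y)).
  apply: littlestone_sub => // -[a b] [/= Sab H]; split=> //= RD.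
  by case: H => -[/= H1 H2]; apply: H2; apply/RD.
move=> /littlestone_preimage; apply: contra_not nDe.
by apply: littlestone_sub => // _ [y _ <-]; exists (join p y).
Qed.

(** Induction on the number of coordinates. With the first coordinate taken as a parameter, the
    induction hypothesis bounds the rank of all fibres over it uniformly, and [littlestone_fibres]
    then bounds the whole. For [m = 0] the space has one point and cannot be split. *)
Lemma tame_tuple m (I : finType) (R : (I -> C) -> ('I_m -> C) -> Prop) :
  zdefinable (fun v : I + 'I_m -> C => R (v \o inl) (v \o inr)) ->
  tame (range R).
Proof.
elim: m I R => [|m IHm] I R dR.
  exists 1%N => -[_ [[y _ <-] [a [_ Ra]] [b [_ nRb]]]]; apply: nRb.
  by have -> : b = a by apply/funext => -[].
pose cons (a : C) (w : 'I_m -> C) (i : 'I_m.+1) :=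
  if unlift ord0 i is Some j then w j else a.
pose R2 y a b := R y (cons a b).
have dR2 : zdefinable (fun v : (I + unit) + 'I_m -> C =>
    R2 (v \o inl \o inl) (v (inl (inr tt))) (v \o inr)).
  pose g (x : I + 'I_m.+1) : (I + unit) + 'I_m := match x with
    | inl y => inl (inl y)
    | inr i => if unlift ord0 i is Some j then inr j else inl (inr tt) end.
  apply: zdefinable_ext (zdefinable_comp g dR) => v; rewrite /R2.
  suff -> : (v \o g) \o inr = cons (v (inl (inr tt))) (v \o inr) by [].
  by apply/funext => i; rewrite /cons /=; case: unlift.
have [d nd] := IHm (I + unit)%type
  (fun y => R2 (y \o inl) (y (inr tt))) dR2.
have [||e ne] := @littlestone_fibres I 'I_m R2 dR2 d void (fun _ _ _ => True).
- exact: zdefinable_True.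
- move=> _ a; apply: contra_not nd; apply: littlestone_sub => //.
  by move=> _ [y _ <-]; exists (join y (fun=> a)).
have /(tame_preimage (fun x : 'I_m.+1 -> C => (x ord0, x \o lift ord0))) :
    tame (range (fun y (x : C * ('I_m -> C)) => R2 y x.1 x.2)).
  by exists e; have := ne (of_void C); apply: contra_not; apply: littlestone_sub.
apply: tame_sub.
move=> _ [y _ <-]; exists (fun x => R2 y x.1 x.2); first by exists y.
apply/predeqP => x; rewrite /R2 /=.
suff -> : cons (x ord0) (x \o lift ord0) = x by [].
by apply/funext => i; rewrite /cons; case: unliftP => [j|] ->.
Qed.

Lemma tame_stable : stable C.
Proof.
move=> m n phi [a [b ab]].
have [d nd] : tame (range (fun (y : 'I_n -> C) (x : 'I_m -> C) => sat (join x y) phi)).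
  apply: tame_tuple.
  pose g (x : 'I_m + 'I_n) : 'I_n + 'I_m := match x with
    | inl y => inr y | inr y => inl y end.
  apply: zdefinable_ext (zdefinable_comp g (zdefinable_sat C phi)) => v.
  suff -> : v \o g = join (v \o inr) (v \o inl) by [].
  by apply/funext => -[].
by apply: nd; apply: littlestone_ladder ab.
Qed.

End OneVariable.

(** * Reduction to independence dimension 1 *)

Section BooleanCombinations.
Variables (L : language) (C : structure L).

(** A single tame formula is wanted because being one of its instances is expressible by a formula,
    as saturation requires. Intersections concatenate the parameter tuples. *)
Lemma tame_boolean_combination n (k : 'I_n -> nat)
    (psi : forall i : 'I_n, formula L (unit + 'I_(k i)))
    (c : forall i : 'I_n, 'I_(k i) -> C) (A : set C) :
  (forall i, tame (range (@instance L C _ (psi i)))) ->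
  boolean_combination (fun i => instance (psi i) (c i)) A ->
  exists l (theta : formula L (unit + 'I_l)) (d : 'I_l -> C),
    tame (range (@instance L C l theta)) /\ A = instance theta d.
Proof.
move=> tpsi; elim=> [i||B _ [l [th [d [tth ->]]]]|
  B B' _ [l [th [d [tth ->]]]] _ [l' [th' [d' [tth' ->]]]]].
- by exists (k i), (psi i), (c i).
- have [th thP] := zdefinable_True C (unit + 'I_0).
  exists 0%N, th, (fun i : 'I_0 => False_rect _ (notF (ltn_ord i))); split.
    by exists 1%N => -[_ [[y _ <-] _ [b [_ nb]]]]; apply: nb; apply/thP.
  by apply/predeqP => x; split=> // _; apply/thP.
- exists l, (fNot th), d; split=> //.
  by apply: tame_sub (tame_setC tth) => _ [y _ <-]; exists (instance th y) => //; exists y.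
have dI : zdefinable (fun v : unit + 'I_(l + l') -> C =>
    instance th (v \o (inr \o lshift l')) (v (inl tt)) /\
    instance th' (v \o (inr \o @rshift l l')) (v (inl tt))).
  by apply: zdefinable_and; exact: zdefinable_instance.
have {dI}[ch chP] := dI.
have chE (y : 'I_(l + l') -> C) : instance ch y =
    instance th (y \o lshift l') `&` instance th' (y \o @rshift l l').
  by apply/predeqP => x; exact: (chP (join (fun _ : unit => x) y)).
exists (l + l')%N, ch, (fun i => join d d' (fintype.split i)); split.
  apply: tame_sub (tame_setI tth tth') => _ [y _ <-].
  exists (instance th (y \o lshift l')); first by exists (y \o lshift l').
  by exists (instance th' (y \o @rshift l l')).
rewrite chE; congr (_ `&` _); congr instance; apply/funext => i /=.
  by rewrite (unsplitK (inl i)).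
by rewrite (unsplitK (inr i)).
Qed.

Variable K : Type.
Hypothesis satC : saturated C K.

(** The formulas given by weak VC-minimality depend on [b]. The type saying that [phi] at [b] is an
    instance of no tame formula is not realised, so by saturation a finite part of it already fails,
    and finitely many tame families cover all instances of [phi]. *)
Lemma weakly_VC_minimal_tame : weakly_VC_minimal C ->
  (forall k (psi : formula L (unit + 'I_k)),
    indep_dim_le1 C psi -> tame (range (@instance L C k psi))) ->
  forall m (phi : formula L (unit + 'I_m)), tame (range (@instance L C m phi)).
Proof.
move=> wvc tpsi m phi; have [c0] := carrier_inhabited C.
pose omits k (th : formula L (unit + 'I_k)) (b : 'I_m -> C) :=
  forall z, instance phi b <> instance th z.
pose p : set (formula L ('I_m + K)) := [set chi |
  exists k (th : formula L (unit + 'I_k)), tame (range (@instance L C k th)) /\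
  forall v : 'I_m + K -> C, sat v chi <-> omits k th (v \o inl)].
(* The truth of a formula in [p] depends only on the first [m] variables, so an arbitrary constant
   [c0] fills the others. *)
have [fsp|] := pselect (finitely_satisfiable (fun _ : K => c0) p).
  have [b bp] := satC fsp; exfalso.
  have [n [k [psi [c [ipsi bc]]]]] := wvc m phi b.
  have [l [th [d [tth E]]]] := tame_boolean_combination (fun i => tpsi _ _ (ipsi i)) bc.
  have [chi chiP] : zdefinable (fun v : 'I_m + K -> C => omits l th (v \o inl)).
    apply: zdefinable_forall.
    apply: (@zdefinable_ext _ _ _ (fun v : ('I_m + K) + 'I_l -> C => ~ forall a,
        instance phi (v \o (inl \o inl)) a <-> instance th (v \o inr) a)).
      move=> v; split=> H E'; apply: H; last exact/predeqP.
      by move=> a; have -> : instance phi (v \o (inl \o inl)) = instance th (v \o inr).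
    apply/zdefinable_not/zdefinable_forall1/zdefinable_iff.
      exact: (zdefinable_instance C phi None (Some \o (inl \o inl))).
    exact: (zdefinable_instance C th None (Some \o inr)).
  suff : sat (join b (fun _ : K => c0)) chi by move=> /chiP /(_ d).
  by apply: bp; exists l, th.
move=> /existsNP[q] /not_implyP[fq] /not_implyP[qp] /forallNP nq.
(* These are the instances at tuples violating some formula in [q]. For the unsatisfied [q] they are
   all instances of [phi], and in this form the claim allows induction on [q]. *)
pose F (q : set (formula L ('I_m + K))) := [set B | exists chi (b : 'I_m -> C),
  [/\ q chi, ~ sat (join b (fun _ : K => c0)) chi & B = instance phi b]].
suff tF : tame (F q).
  apply: tame_sub tF => _ [b _ <-].
  have /existsNP[chi /not_implyP[qchi nchi]] := nq b.
  by exists chi, b.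
move: {nq} q fq qp; apply: finite_set_ind => [_|q chi IHq qp].
  by exists 1%N => -[B [[chi [b []]]]].
have [|k [th [tth chiP]]] := qp chi; first by left.
apply: tame_sub (tame_setU tth (IHq _)); last by move=> x qx; apply: qp; right.
move=> _ [chi' [b [[->|qchi'] nsat ->]]]; last by right; exists chi', b.
left; move: nsat; rewrite chiP /omits => /existsNP[z /contrapT].
by move=> ->; exists z.
Qed.

End BooleanCombinations.

(** * The linear order *)

Section LinearOrder.
Variables (L : language) (C : structure L) (k : nat).
Variable psi : formula L (unit + 'I_k).
Hypothesis psi1 : indep_dim_le1 C psi.

Definition separates (a a' : C) (c : 'I_k -> C) : Prop :=
  instance psi c a /\ ~ instance psi c a'.

(** The [n] parameter tuples are packed into one map [z], so that a single block of quantifiers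
    expresses the condition. *)
Definition many_separate (n : nat) (a a' : C) : Prop :=
  exists z : 'I_n * 'I_k -> C,
    (forall i, separates a a' (fun j => z (i, j))) /\
    (forall i i', i != i' ->
      instance psi (fun j => z (i, j)) <> instance psi (fun j => z (i', j))).

Lemma many_separate_leq m n a a' :
  (m <= n)%N -> many_separate n a a' -> many_separate m a a'.
Proof.
move=> mn [z [zs zd]]; exists (fun x => z (widen_ord mn x.1, x.2)); split=> [i|].
  exact: (zs (widen_ord mn i)).
move=> i i' ii'; apply: (zd (widen_ord mn i) (widen_ord mn i')).
by apply: contra ii' => /eqP/(congr1 val)/= /val_inj ->.
Qed.

Lemma not_tame_many_separate n : ~ tame (range (@instance L C k psi)) ->
  exists a a', many_separate n a a'.
Proof.
move=> /(not_tame_separating n (carrier_inhabited C)) [a [a' [s [ss us sP]]]].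
exists a, a'.
have /choice[z zP] (i : 'I_n) : exists c, instance psi c = nth set0 s i.
  have /sP[[c _ cE] _ _] : nth set0 s i \in s by rewrite mem_nth ?ss.
  by exists c.
exists (fun x => z x.1 x.2); split=> [i|i i' ii'] /=.
  have /sP[_] : nth set0 s i \in s by rewrite mem_nth ?ss.
  by rewrite -zP.
move/eqP: ii'; apply: contra_not; rewrite -/(z i) -/(z i').
rewrite (_ : (fun j => z i j) = z i) // (_ : (fun j => z i' j) = z i') // !zP.
by move/eqP; rewrite nth_uniq ?ss // => /eqP/val_inj.
Qed.

Lemma zdefinable_separates (V : Type) (x x' : V) (y : 'I_k -> V) :
  zdefinable (fun v : V -> C => separates (v x) (v x') (v \o y)).
Proof.
apply: zdefinable_and; first exact: zdefinable_instance.
by apply: zdefinable_not; exact: zdefinable_instance.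
Qed.

Lemma zdefinable_sub_instance (V : Type) (y y' : 'I_k -> V) :
  zdefinable (fun v : V -> C => instance psi (v \o y) `<=` instance psi (v \o y')).
Proof.
apply: zdefinable_forall1; apply: zdefinable_imp.
  exact: (zdefinable_instance C psi None (Some \o y)).
exact: (zdefinable_instance C psi None (Some \o y')).
Qed.

Lemma zdefinable_eq_instance (V : Type) (y y' : 'I_k -> V) :
  zdefinable (fun v : V -> C => instance psi (v \o y) = instance psi (v \o y')).
Proof.
apply: zdefinable_ext (zdefinable_and (zdefinable_sub_instance y y')
  (zdefinable_sub_instance y' y)) => v.
by rewrite eqEsubset.
Qed.

Lemma zdefinable_many_separate n (V : Type) (x x' : V) :
  zdefinable (fun v : V -> C => many_separate n (v x) (v x')).
Proof.
apply: zdefinable_exists; apply: zdefinable_and.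
  apply: zdefinable_all => i.
  exact: (zdefinable_separates (inl x) (inl x') (fun j => inr (i, j))).
apply: zdefinable_all => i; apply: zdefinable_all => i'.
have [->|ii'] := eqVneq i i'.
  by apply: zdefinable_ext (zdefinable_True _ _).
apply: zdefinable_imp; first by apply: zdefinable_ext (zdefinable_True _ _).
apply: zdefinable_not.
exact: (zdefinable_eq_instance (fun j => inr (i, j)) (fun j => inr (i', j))).
Qed.

(** The conditions grow stronger with [n], so finitely many of them follow from a single one, which
    some pair satisfies by [not_tame_many_separate]. *)
Lemma saturated_many_separate (K : Type) : saturated C K ->
  ~ tame (range (@instance L C k psi)) ->
  exists a a', forall n, many_separate n a a'.
Proof.
move=> satC ntame; have [c0] := carrier_inhabited C.
pose x0 : 'I_2 := ord0; pose x1 : 'I_2 := ord_max.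
pose p : set (formula L ('I_2 + K)) := [set chi | exists n,
  forall v : 'I_2 + K -> C,
    sat v chi <-> many_separate n (v (inl x0)) (v (inl x1))].
have [|a ap] := satC 2 (fun=> c0) p; last first.
  exists (a x0), (a x1) => n.
  have [chi chiP] := zdefinable_many_separate n (inl x0 : 'I_2 + K) (inl x1).
  by apply: (chiP (join a (fun=> c0))).1; apply: ap; exists n.
move=> q fq qp.
have [n nP] : exists n, forall chi, q chi -> forall a : 'I_2 -> C,
    many_separate n (a x0) (a x1) -> sat (join a (fun=> c0)) chi.
  move: q fq qp; apply: finite_set_ind => [_|q chi IHq qp].
    by exists 0%N.
  have [|m mP] := qp chi; first by left.
  have [|n nP] := IHq; first by move=> x qx; apply: qp; right.
  exists (m + n)%N => x [->|qx] a mn.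
    by apply/mP; apply: many_separate_leq (leq_addr n m) mn.
  by apply: nP => //; apply: many_separate_leq (leq_addl m n) mn.
have [a [a' aa']] := not_tame_many_separate n ntame.
exists (fun i => if i == ord0 then a else a') => chi qchi.
exact: nP.
Qed.

(** If both inclusions fail, their witnesses together with [a], in both sets, and [a'], in neither,
    show independence, which [psi1] excludes for distinct instances. *)
Lemma instance_comparable a a' c c' : separates a a' c -> separates a a' c' ->
  instance psi c `<=` instance psi c' \/ instance psi c' `<=` instance psi c.
Proof.
move=> [ca ca'] [c'a c'a'].
have [E|E] := pselect (instance psi c = instance psi c').
  by left; rewrite E.
apply: contrapT => /not_orP[/existsNP[x /not_implyP[cx c'x]]].
move=> /existsNP[y /not_implyP[c'y cy]]; apply: (psi1 E) => -[] [].
- by exists a.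
- by exists x.
- by exists y.
- by exists a'.
Qed.

Variables a a' : C.
Hypothesis aa' : forall n, many_separate n a a'.

(** The points are the sets and not their parameters, so that inclusion is antisymmetric. *)
Definition separating_instance : Type :=
  {B : set C | exists2 c, separates a a' c & B = instance psi c}.

Definition separating_instance_of c (cs : separates a a' c) : separating_instance :=
  exist _ (instance psi c) (ex_intro2 _ _ c cs erefl).

Lemma separating_instance_inhabited : inhabited separating_instance.
Proof.
have [z [zs _]] := aa' 1.
exact: inhabits (separating_instance_of (zs ord0)).
Qed.

Definition inclusion_order : structure order_language :=
  @Structure order_language separating_instance separating_instance_inhabited
    (fun f => match f with end)
    (fun _ v => sval (v ord0) `<=` sval (v ord_max)).

Lemma inclusion_order_inj (B B' : inclusion_order) : sval B = sval B' -> B = B'.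
Proof. by case: B B' => [B p] [B' p'] /= E; apply: eq_exist. Qed.

Lemma leN_inclusion (B B' : inclusion_order) :
  leN B B' <-> sval B `<=` sval B'.
Proof. by []. Qed.

Lemma inclusion_order_linear : linear_order inclusion_order.
Proof.
split.
- by move=> B; apply/leN_inclusion.
- move=> B B' /leN_inclusion BB' /leN_inclusion B'B.
  by apply: inclusion_order_inj; apply/seteqP.
- move=> B B' B'' /leN_inclusion BB' /leN_inclusion B'B''.
  by apply/leN_inclusion; exact: subset_trans B'B''.
move=> [B [c cs E]] [B' [c' cs' E']]; subst.
by have [H|H] := instance_comparable cs cs'; [left|right]; apply/leN_inclusion.
Qed.

Lemma inclusion_order_infinite : infinite_set [set: inclusion_order].
Proof.
move=> /finite_setP[n /card_eqPle[le_n _]].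
(* One more distinct instance than the supposed number [n] of points. *)
have [z [zs zd]] := aa' n.+1.
pose f (i : 'I_n.+1) : inclusion_order := separating_instance_of (zs i).
have : [set: 'I_n.+1] #<= `I_n.
  apply: card_le_trans le_n; rewrite -(card_le_eql (@inj_card_eq _ _ setT f _)).
    exact: card_leT.
  move=> i i' _ _ /(congr1 sval)/= E; apply/eqP; apply: contrapT => /negP ii'.
  exact: zd ii' E.
by rewrite -(card_le_eql card_II) card_le_II ltnn.
Qed.

(** A point is coded by any tuple [c] defining it, with [a] and [a'] as the parameters of all the
    definitions; equality and order pull back to equality and inclusion of instances. *)
Lemma inclusion_order_interpreted : interprets C inclusion_order.
Proof.
have [B0] := separating_instance_inhabited.
have /choice[f fP] (c : 'I_k -> C) : exists B : inclusion_order,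
    separates a a' c -> sval B = instance psi c.
  (* Tuples outside the domain are sent to the arbitrary point [B0]. *)
  have [cs|ncs] := pselect (separates a a' c); last by exists B0.
  by exists (separating_instance_of cs).
pose ends (i : 'I_2) := if i == ord0 then a else a'.
exists k, (separates a a'), f; split.
- exact: (definable_zdefinable ends
    (zdefinable_separates (inr ord0) (inr ord_max) inl)).
- apply/predeqP => -[B [c cs E]]; split=> // _; exists c => //.
  by apply: inclusion_order_inj; rewrite fP.
- pose P (v : ('I_k + 'I_k) + 'I_2 -> C) :=
    (separates (v (inr ord0)) (v (inr ord_max)) (v \o (inl \o inl)) /\
     separates (v (inr ord0)) (v (inr ord_max)) (v \o (inl \o inr))) /\
    instance psi (v \o (inl \o inl)) = instance psi (v \o (inl \o inr)).
  have dP : zdefinable P.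
    apply: zdefinable_and; last exact: zdefinable_eq_instance.
    by apply: zdefinable_and; exact: zdefinable_separates.
  have := definable_zdefinable ends dP; congr definable; apply/predeqP => v /=.
  split=> [[[s1 s2] E]|[s1 s2 E]]; last first.
    by split=> //; rewrite /= -!fP // E.
  by split=> //; apply: inclusion_order_inj; rewrite !fP.
- by case.
case; pose P (v : ('I_2 * 'I_k) + 'I_2 -> C) :=
  (forall i, separates (v (inr ord0)) (v (inr ord_max)) (v \o (fun j => inl (i, j)))) /\
  instance psi (v \o (fun j => inl (ord0, j))) `<=`
  instance psi (v \o (fun j => inl (ord_max, j))).
have dP : zdefinable P.
  apply: zdefinable_and; last exact: zdefinable_sub_instance.
  by apply: zdefinable_all => i; exact: zdefinable_separates.
have := definable_zdefinable ends dP; congr definable; apply/predeqP => v /=.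
by split=> -[s]; rewrite /P /= !fP; try exact: s; split.
Qed.

End LinearOrder.

Theorem theorem3p5 (L : language) (T : set (sentence L)) (K : Type)
    (C : structure L) :
  complete_theory T -> monster_model T K C ->
  weakly_VC_minimal C -> stable C \/ interprets_infinite_linear_order C.
Proof.
move=> _ [_ _ satC _] wvc.
have [tpsi|] := pselect (forall k (psi : formula L (unit + 'I_k)),
  indep_dim_le1 C psi -> tame (range (@instance L C k psi))).
  by left; apply: tame_stable; exact: weakly_VC_minimal_tame satC wvc tpsi.
move=> /existsNP[k] /existsNP[psi] /not_implyP[psi1 ntame]; right.
have [a [a' aa']] := saturated_many_separate satC ntame.
exists (inclusion_order aa'); split.
- exact: inclusion_order_linear.
- exact: inclusion_order_infinite.
- exact: inclusion_order_interpreted.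
Qed.
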